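(* Let $b$ be a locally finite, connected graph over $(X,m)$, $q:X\to\mathbb{R}$, with associated form $h$, and let $d$ be an intrinsic metric. Let $w:X\to[0,\infty)$ be such that $h\ge w$ on $C_c(X)$. Let $$\rho_{d,w}(x,y)=\inf_{x=x_0\sim\ldots\sim x_n=y}\sum_{i=0}^{n-1}\min\Big\{1,\ \big(w(x_i)\wedge w(x_{i+1})\big)^{1/2}d(x_i,x_{i+1})\Big\},$$ assume that $(X,\rho_{d,w})$ is a complete metric space, and let $\rho=\rho_{d,w}(o,\cdot)$ for a fixed vertex $o\in X$. Let $f\in C(X)$ and let $u\in\mathcal{F}$ be a solution of $\mathcal{H}u=f$ or a positive subsolution (i.e. $u\ge0$ and $\mathcal{H}u\le f$). If there is $\alpha>0$ such that $\alpha^2e^\alpha/8<1$ and $$u\in\ell^2(X,e^{-\alpha\rho}wm),$$ then, with $C=(1-\alpha^2e^\alpha/8)^{-2}$, $$\sum_Xu^2e^{\alpha\rho}wm\le C\sum_Xf^2e^{\alpha\rho}w^{-1}m.$$ In particular, whenever $f$ is finitely supported within the support of $w$, then $$u\in\ell^2(X,e^{\alpha\rho}wm).$$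
   Context: $X$ is an infinite countable set, $m:X\to(0,\infty)$, and a graph $b$ over $(X,m)$ is a symmetric function $b:X\times X\to[0,\infty)$ with zero diagonal and $\sum_{y}b(x,y)<\infty$ for all $x$; $x\sim y$ means $b(x,y)>0$; the graph is locally finite if $\#\{y:y\sim x\}<\infty$ for all $x$. $C(X)$ is the space of real functions on $X$, $C_c(X)$ those with finite support. For $f\in C(X)$, $|\nabla f|^2(x)=\frac{1}{2m(x)}\sum_{y}b(x,y)(f(x)-f(y))^2$. $h(\varphi)=\sum_{X}(|\nabla\varphi|^2+q\varphi^2)m$ for $\varphi\in C_c(X)$; ''$h\ge w$ on $C_c(X)$'' means $h(\varphi)\ge\sum_X w\varphi^2m$ for all $\varphi\in C_c(X)$. The formal operator is $\mathcal{H}f(x)=\frac1{m(x)}\sum_y b(x,y)(f(x)-f(y))+q(x)f(x)$ on $\mathcal{F}=\{f\in C(X):\sum_y b(x,y)|f(y)|<\infty\ \forall x\in X\}$. An intrinsic metric is a pseudo-metric $d:X\times X\to[0,\infty)$ (symmetric, zero on the diagonal, triangle inequality) with $\sum_yb(x,y)d(x,y)^2\le m(x)$ for all $x\in X$. For a weight $\mu\ge0$, $u\in\ell^2(X,\mu)$ means $\sum_Xu^2\mu<\infty$. In $f^2w^{-1}$ the value is $0$ where $f=0$ and $+\infty$ where $f\neq0$ and $w=0$. The support of $w$ is $\{x:w(x)>0\}$. *)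

(* Defs.v *)
From HB Require Import structures.
From mathcomp Require Import all_boot all_order all_algebra.
From mathcomp Require Import all_classical all_reals all_analysis.
Import Order.TTheory GRing.Theory Num.Theory.
Import numFieldNormedType.Exports.

Set Implicit Arguments.
Unset Strict Implicit.
Unset Printing Implicit Defensive.

Local Open Scope classical_set_scope.
Local Open Scope ring_scope.

(* Sum of an absolutely summable real family, as the difference of the sums of
   its positive and negative parts.  The value is meaningful only for absolutely
   summable families, which is the case wherever it is used below: in
   [laplace b m q f] for [f] in [formal_domain b], in [grad2 b m f] for [f]
   finitely supported, and in [form] and [form_ge] for finitely supported
   functions. *)
Definition rsum (R : realType) (X : choiceType) (f : X -> R) : R :=
  fine (\esum_(x in [set: X]) (EFin \o f)^\+ x
        - \esum_(x in [set: X]) (EFin \o f)^\- x)%E.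

Record is_graph (R : realType) (X : choiceType) (b : X -> X -> R) : Prop := {
  graph_ge0 : forall x y, 0 <= b x y;
  graph_sym : forall x y, b x y = b y x;
  graph_diag : forall x, b x x = 0;
  graph_summable : forall x, (\esum_(y in [set: X]) (b x y)%:E < +oo)%E
}.

Definition adj (R : realType) (X : choiceType) (b : X -> X -> R) : rel X :=
  [rel x y | 0 < b x y].

Definition locally_finite_graph (R : realType) (X : choiceType)
    (b : X -> X -> R) : Prop :=
  forall x, finite_set [set y | adj b x y].

Definition connected_graph (R : realType) (X : choiceType)
    (b : X -> X -> R) : Prop :=
  forall x y, exists2 p : seq X, path (adj b) x p & last x p = y.

Definition finitely_supported (R : realType) (X : choiceType)
    (f : X -> R) : Prop :=
  finite_set [set x | f x != 0].

Definition grad2 (R : realType) (X : choiceType) (b : X -> X -> R)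
    (m : X -> R) (f : X -> R) (x : X) : R :=
  (2 * m x)^-1 * rsum (fun y => b x y * (f x - f y) ^+ 2).

Definition form (R : realType) (X : choiceType) (b : X -> X -> R)
    (m q : X -> R) (phi : X -> R) : R :=
  rsum (fun x => (grad2 b m phi x + q x * phi x ^+ 2) * m x).

Definition form_ge (R : realType) (X : choiceType) (b : X -> X -> R)
    (m q w : X -> R) : Prop :=
  forall phi : X -> R, finitely_supported phi ->
    rsum (fun x => w x * phi x ^+ 2 * m x) <= form b m q phi.

Definition formal_domain (R : realType) (X : choiceType) (b : X -> X -> R)
    : set (X -> R) :=
  [set f | forall x, (\esum_(y in [set: X]) (b x y * `|f y|)%:E < +oo)%E].

Definition laplace (R : realType) (X : choiceType) (b : X -> X -> R)
    (m q : X -> R) (f : X -> R) (x : X) : R :=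
  (m x)^-1 * rsum (fun y => b x y * (f x - f y)) + q x * f x.

Record is_pseudo_metric (R : realType) (X : choiceType)
    (d : X -> X -> R) : Prop := {
  pmetric_ge0 : forall x y, 0 <= d x y;
  pmetric_diag : forall x, d x x = 0;
  pmetric_sym : forall x y, d x y = d y x;
  pmetric_triangle : forall x y z, d x z <= d x y + d y z
}.

Definition intrinsic_metric (R : realType) (X : choiceType) (b : X -> X -> R)
    (m : X -> R) (d : X -> X -> R) : Prop :=
  is_pseudo_metric d /\
  forall x, (\esum_(y in [set: X]) (b x y * d x y ^+ 2)%:E <= (m x)%:E)%E.

Definition edge_length (R : realType) (X : choiceType) (d : X -> X -> R)
    (w : X -> R) (x y : X) : R :=
  Num.min 1 (Num.sqrt (Num.min (w x) (w y)) * d x y).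

(* The length of the path x = x_0, x_1, ..., x_n with p = [:: x_1; ...; x_n]. *)
Definition path_length (R : realType) (X : choiceType) (d : X -> X -> R)
    (w : X -> R) (x : X) (p : seq X) : R :=
  \sum_(e <- zip (x :: p) p) edge_length d w e.1 e.2.

(* The trivial path (n = 0) is allowed, so that rho_dist b d w x x = 0. *)
Definition rho_dist (R : realType) (X : choiceType) (b d : X -> X -> R)
    (w : X -> R) (x y : X) : R :=
  inf [set path_length d w x p | p in
         [set p : seq X | path (adj b) x p /\ last x p = y]].

Definition is_metric (R : realType) (X : choiceType)
    (rho : X -> X -> R) : Prop :=
  is_pseudo_metric rho /\ forall x y, rho x y = 0 -> x = y.

(* A copy of X carrying the metricType structure given by rho. *)
Definition metric_space (R : realType) (X : choiceType) (rho : X -> X -> R)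
    (hrho : is_metric rho) : Type := X.

Section MetricSpace.
Variables (R : realType) (X : choiceType) (rho : X -> X -> R).
Variable hrho : is_metric rho.

HB.instance Definition _ := Choice.on (metric_space hrho).

Let dist (x y : metric_space hrho) : R := rho x y.

Let dist_positivity x y : dist x y = 0 -> x = y.
Proof. exact: hrho.2. Qed.

Let dist_refl x : dist x x = 0.
Proof. exact: (pmetric_diag hrho.1). Qed.

Let dist_sym x y : dist x y = dist y x.
Proof. exact: (pmetric_sym hrho.1). Qed.

Let dist_triangle x y z : dist x z <= dist x y + dist y z.
Proof. exact: (pmetric_triangle hrho.1). Qed.

HB.instance Definition _ := @isMetric.Build R (metric_space hrho) dist
  dist_refl dist_positivity dist_sym (fun y x z => dist_triangle x y z).

End MetricSpace.

Definition complete_metric (R : realType) (X : choiceType)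
    (rho : X -> X -> R) : Prop :=
  exists hrho : is_metric rho,
  forall F : set_system (metric_space hrho), ProperFilter F ->
    cauchy F -> exists x : metric_space hrho, F --> x.

Definition weighted_ell2 (R : realType) (X : choiceType) (mu u : X -> R)
    : Prop :=
  (\esum_(x in [set: X]) (u x ^+ 2 * mu x)%:E < +oo)%E.

(* f^2 w^{-1}, equal to 0 where f = 0 and to +oo where f != 0 and w = 0. *)
Definition sqr_over (R : realType) (X : choiceType) (f w : X -> R) (x : X)
    : \bar R :=
  if f x == 0 then 0%E
  else if w x == 0 then +oo%E
  else (f x ^+ 2 / w x)%:E.

(* Main.v *)
(* Test the inequality h >= w on u phi.  The ground state representation gives
     h(u phi) = sum u (Hu) phi^2 m + 1/2 sum b(x,y) u(x) u(y) (phi(x)-phi(y))^2,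
   and for phi = exp(alpha g / 2) with g 1-Lipschitz for rho the last sum is at
   most c sum u^2 phi^2 w m, c = alpha^2 e^alpha / 8, since rho is at most 1 and
   at most (w(x) /\ w(y))^{1/2} d(x,y) across an edge and d is intrinsic.
   Absorbing u f phi^2 by AM-GM yields the estimate with weight phi^2.
   Taking g = min(rho, 2k - rho), the phi-weighted norm of u is finite by the a
   priori assumption, and phi can be truncated to finite support because balls
   of rho are finite (a discrete Hopf-Rinow theorem).  Finally k grows. *)

Require Import Defs.
From mathcomp Require Import all_boot all_order all_algebra.
From mathcomp Require Import all_classical all_reals all_analysis.
From mathcomp Require Import ring lra.
Import Order.TTheory GRing.Theory Num.Theory.
Import numFieldNormedType.Exports.

Set Implicit Arguments.
Unset Strict Implicit.
Unset Printing Implicit Defensive.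

Local Open Scope classical_set_scope.
Local Open Scope ring_scope.

(** * Finite sums against [esum] and [rsum] *)

Lemma esum_seqE (R : realType) (X : choiceType) (a : X -> R) (s : seq X) :
  uniq s -> (forall x, 0 <= a x) -> (forall x, x \notin s -> a x = 0) ->
  (\esum_(x in [set: X]) (a x)%:E = (\sum_(x <- s) a x)%:E)%E.
Proof.
move=> us a0 as0; rewrite -sumEFin fsbig_seq// -esum_fset; last first.
- by move=> x _; rewrite lee_fin.
- exact: finite_seq.
rewrite [RHS]esum_mkcond; apply: eq_esum => x _.
rewrite mem_setE; case: ifPn => //= xs.
by rewrite as0// mem_setE.
Qed.

Lemma sum_seq_le_esum (R : realType) (X : choiceType) (a : X -> R)
    (s : seq X) : uniq s ->
  ((\sum_(x <- s) a x)%:E <= \esum_(x in [set: X]) (a x)%:E)%E.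
Proof.
move=> us; apply: esum_ge; exists [set` s].
  by split => //; exact: finite_seq.
by rewrite -sumEFin fsbig_seq.
Qed.

Lemma esum_le_seq (R : realType) (X : choiceType) (a : X -> R) (M : \bar R) :
  (forall s, uniq s -> ((\sum_(x <- s) a x)%:E <= M)%E) ->
  (\esum_(x in [set: X]) (a x)%:E <= M)%E.
Proof.
move=> aM; apply: ge_ereal_sup => _ [A [finA _] <-].
by rewrite fsbig_finite// sumEFin aM.
Qed.

Lemma rsumE (R : realType) (X : choiceType) (f : X -> R) (s : seq X) :
  uniq s -> (forall x, x \notin s -> f x = 0) ->
  rsum f = \sum_(x <- s) f x.
Proof.
move=> us f0; rewrite /rsum.
have -> : (\esum_(x in [set: X]) (EFin \o f)^\+ x =
    (\sum_(x <- s) Num.max (f x) 0)%:E)%E.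
  rewrite -esum_seqE//.
  - by apply: eq_esum => x _; rewrite funeposE /= EFin_max.
  - by move=> x; rewrite le_max lexx orbT.
  - by move=> x /f0 ->; rewrite maxxx.
have -> : (\esum_(x in [set: X]) (EFin \o f)^\- x =
    (\sum_(x <- s) Num.max (- f x) 0)%:E)%E.
  rewrite -esum_seqE//.
  - by apply: eq_esum => x _; rewrite funenegE /= EFin_max.
  - by move=> x; rewrite le_max lexx orbT.
  - by move=> x /f0 ->; rewrite oppr0 maxxx.
rewrite -EFinB /= -sumrB; apply: eq_bigr => x _.
have [f_le0|f_gt0] := leP (f x) 0.
  by rewrite max_l ?oppr_ge0// opprK add0r.
by rewrite max_r ?subr0// oppr_le0 ltW.
Qed.

(** * The path metric and finiteness of its balls *)

Section PathMetric.
Variables (R : realType) (X : choiceType) (b d : X -> X -> R) (w : X -> R).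
Hypothesis d_ge0 : forall x y, 0 <= d x y.

Let len := edge_length d w.
Let rho := rho_dist b d w.

Lemma edge_length_ge0 x y : 0 <= len x y.
Proof. by rewrite /len /edge_length le_min ler01 mulr_ge0 ?sqrtr_ge0. Qed.

Lemma path_length_cons x z p :
  path_length d w x (z :: p) = len x z + path_length d w z p.
Proof. by rewrite /path_length /= big_cons. Qed.

Lemma path_length_ge0 x p : 0 <= path_length d w x p.
Proof. by apply: sumr_ge0 => e _; exact: edge_length_ge0. Qed.

Lemma rho_dist_le_path x p : path (adj b) x p ->
  rho x (last x p) <= path_length d w x p.
Proof.
move=> bp; apply: ge_inf; last by exists p.
by exists 0 => _ [p' _ <-]; exact: path_length_ge0.
Qed.

Lemma rho_dist_le_edge x y : adj b x y -> rho x y <= len x y.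
Proof.
move=> xy; have /= := @rho_dist_le_path x [:: y].
by rewrite andbT path_length_cons /path_length /= big_nil addr0; exact.
Qed.

Hypothesis conn_b : connected_graph b.

Lemma rho_dist_lt_path x y r : rho x y < r ->
  exists p, [/\ path (adj b) x p, last x p = y & path_length d w x p < r].
Proof.
move=> /inf_lt[|_ [p [bp <-] <-] pr].
  by have [p bp py] := conn_b x y; exists (path_length d w x p), p.
by exists p.
Qed.

Lemma le_rho_dist x y r :
  (forall p, path (adj b) x p -> last x p = y -> r <= path_length d w x p) ->
  r <= rho x y.
Proof.
move=> rp; apply: lb_le_inf.
  by have [p bp py] := conn_b x y; exists (path_length d w x p), p.
by move=> _ [p [bp py] <-]; exact: rp.
Qed.

Hypothesis lf_b : locally_finite_graph b.
Hypothesis diag_b : forall x, b x x = 0.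

(** A path of length less than [r] is trivial or passes first through a neighbour [z], so the ball
    is covered by the centre and the balls of radius [r - len x z] about the neighbours. These are
    finitely many, hence one of them is infinite. *)
Lemma infinite_ball_step x r : infinite_set [set y | rho x y < r] ->
  exists2 z, adj b x z & infinite_set [set y | rho z y < r - len x z].
Proof.
move=> infB; apply: contrapT => /forall2NP noz; apply: infB.
apply: (@sub_finite_set _ _ ([set x] `|`
    \bigcup_(z in [set z | adj b x z]) [set y | rho z y < r - len x z])).
  move=> y /= /rho_dist_lt_path[[[_ /= <- _]|z p]]; first by left.
  rewrite path_length_cons => -[/= /andP[xz bp] <- lp]; right.
  exists z => //=. apply: (le_lt_trans (rho_dist_le_path bp)).
  by rewrite ltrBrDl.
rewrite finite_setU; split; first exact: finite_set1.
apply: bigcup_finite; first exact: lf_b.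
by move=> z xz; have [|/contrapT] := noz z.
Qed.

Hypothesis complete_rho : complete_metric rho.

(** An edge of length 0 would put its ends at distance 0, hence make it a loop, which the zero
    diagonal of [b] excludes. *)
Lemma edge_length_gt0 x y : adj b x y -> 0 < len x y.
Proof.
have [hrho _] := complete_rho => xy; rewrite lt_neqAle edge_length_ge0 andbT.
apply/eqP => len0; have : x = y.
  apply: hrho.2; apply/eqP; rewrite eq_le (pmetric_ge0 hrho.1) andbT.
  by rewrite [leRHS]len0 rho_dist_le_edge.
by move=> xeqy; move: xy; rewrite xeqy /adj /= diag_b ltxx.
Qed.

(** A path to another vertex starts with one of the finitely many edges at [x], all of positive
    length; [e] is their minimum, capped at 1. *)
Lemma rho_dist_isolated x : exists2 e, 0 < e & forall y, rho x y < e -> y = x.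
Proof.
have /finite_seqP[s sE] := lf_b x.
have [e e0 es] : exists2 e, 0 < e & forall z, z \in s -> e <= len x z.
  have : forall z, z \in s -> 0 < len x z.
    move=> z zs; apply: edge_length_gt0.
    by have : [set` s] z by []; rewrite -sE.
  elim: s {sE} => [_|z s IHs sx]; first by exists 1.
  have [|e e0 es] := IHs; first by move=> y ys; rewrite sx// inE ys orbT.
  exists (Num.min e (len x z)); first by rewrite lt_min e0 sx// mem_head.
  move=> y; rewrite inE => /predU1P[->|/es ey].
    by rewrite ge_min lexx orbT.
  by rewrite ge_min ey.
exists e => // y; apply: contraPeq => /eqP yx; apply/negP; rewrite -leNgt.
apply: le_rho_dist => -[_ /= xy|z p /= /andP[xz _] _].
  by rewrite xy in yx.
rewrite path_length_cons (le_trans (es z _)) ?lerDl ?path_length_ge0//.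
by have : [set y | adj b x y] z by []; rewrite sE.
Qed.

(* An infinite ball would let one walk along edges forever with finite total
   length; the resulting Cauchy sequence cannot converge, as limits are
   isolated and consecutive vertices distinct. *)
Lemma finite_ball x r : finite_set [set y | rho x y < r].
Proof.
apply: contrapT => infB; have [hrho cplt] := complete_rho.
(* A state is a vertex with a remaining radius. Each step of the walk pays the length of its edge
   out of the radius and keeps the ball infinite. *)
pose P (p : X * R) := infinite_set [set y | rho p.1 y < p.2].
have [st stP] : {st : X * R -> X * R & forall p, P p ->
    [/\ adj b p.1 (st p).1, (st p).2 = p.2 - len p.1 (st p).1 & P (st p)]}.
  apply: (@choice _ _ (fun p p' => P p ->
    [/\ adj b p.1 p'.1, p'.2 = p.2 - len p.1 p'.1 & P p'])) => p.
  have [Pp|nPp] := pselect (P p); last by exists p.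
  have [z pz infz] := infinite_ball_step Pp.
  by exists (z, p.2 - len p.1 z).
pose s n := iter n st (x, r).
have sP n : P (s n) by elim: n => //= n /stP[].
have s_ge0 n : 0 <= (s n).2.
  rewrite leNgt; apply/negP => sn; apply: (sP n).
  rewrite (_ : [set _ | _] = set0)//; apply/seteqP; split => // y /=.
  by apply/negP; rewrite -leNgt (le_trans (ltW sn))// (pmetric_ge0 hrho.1).
have rho_s n k : rho (s n).1 (s (n + k)%N).1 <= (s n).2 - (s (n + k)%N).2.
  elim: k => [|k IHk]; first by rewrite addn0 subrr (pmetric_diag hrho.1).
  rewrite addnS; have [sadj sE _] := stP _ (sP (n + k)%N).
  have := pmetric_triangle hrho.1 (s n).1 (s (n + k)%N).1 (s (n + k).+1).1.
  have := rho_dist_le_edge sadj.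
  by rewrite -/rho -/len /= sE; lra.
pose xs n : metric_space hrho := (s n).1.
have /cplt[|z zlim] : ProperFilter (xs @ \oo) by exact: fmap_proper_filter.
  (* Distances along the walk are bounded by drops of the radius, and the radii are bounded below by
     0. From an index whose radius is within [e] of their infimum, every later drop is below [e]. *)
  apply: cauchy_exP => e e0.
  have infs : has_inf (range (fun n => (s n).2)).
    by split; [exists (s 0%N).2, 0%N|exists 0 => _ [n _ <-]].
  have [_ [N _ <-] sN] := inf_adherent e0 infs.
  exists (xs N); exists N => // n /= Nn.
  rewrite ballEmdist /=.
  apply: le_lt_trans (_ : (s N).2 - (s n).2 < e).
    by have := rho_s N (n - N)%N; rewrite subnKC.
  have := ge_inf infs.2 (ex_intro2 _ _ n I (erefl (s n).2)).
  by move: sN; lra.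
have [e e0 ez] := rho_dist_isolated z.
have [N _ xsN] := cvg_ball zlim e0.
have xsz n : (N <= n)%N -> (s n).1 = z.
  by move=> /xsN; rewrite ballEmdist => /ez.
have [+ _ _] := stP _ (sP N).
by rewrite (xsz N)// (xsz N.+1)// /adj /= diag_b ltxx.
Qed.

End PathMetric.

(** * Ground state representation *)

Lemma sum_ground_state (R : realFieldType) (X : choiceType) (b : X -> X -> R)
    (u phi : X -> R) (s : seq X) : (forall x y, b x y = b y x) ->
  2^-1 * (\sum_(x <- s) \sum_(y <- s) b x y * (u x * phi x - u y * phi y) ^+ 2)
  = \sum_(x <- s) \sum_(y <- s) b x y * (u x - u y) * u x * phi x ^+ 2
    + 2^-1 * (\sum_(x <- s) \sum_(y <- s)
                b x y * (u x * u y) * (phi x - phi y) ^+ 2).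
Proof.
move=> bC; set A := (X in X + _).
(* Exchanging [x] and [y] symmetrises the first term, after which the identity holds summand by
   summand. *)
have A2 : A = 2^-1 * (\sum_(x <- s) \sum_(y <- s)
    (b x y * (u x - u y) * u x * phi x ^+ 2 +
     b x y * (u y - u x) * u y * phi y ^+ 2)).
  rewrite (_ : \sum_(x <- s) _ = A + A); first by field.
  transitivity (A + \sum_(x <- s) \sum_(y <- s)
      b x y * (u y - u x) * u y * phi y ^+ 2).
    by rewrite -big_split; apply: eq_bigr => x _; rewrite big_split.
  congr (_ + _); rewrite exchange_big; apply: eq_bigr => x _.
  by apply: eq_bigr => y _; rewrite bC.
rewrite A2 -mulrDr -big_split; congr (_ * _); apply: eq_bigr => x _.
by rewrite -big_split; apply: eq_bigr => y _ /=; ring.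
Qed.

Section GroundState.
Variables (R : realType) (X : choiceType) (b : X -> X -> R).
Hypothesis graph_b : is_graph b.
Variables (m q : X -> R).
Hypothesis m_gt0 : forall x, 0 < m x.
Variables (u phi : X -> R) (s : seq X).
Hypothesis s_uniq : uniq s.
Hypothesis phi_s : forall x, phi x != 0 -> x \in s.
Hypothesis phi_nbr_s : forall x y, phi x != 0 -> adj b x y -> y \in s.

Let phi0 x : x \notin s -> phi x = 0.
Proof. by apply: contraNeq; exact: phi_s. Qed.

Let b0 x y : phi x != 0 -> y \notin s -> b x y = 0.
Proof.
move=> x0; apply: contraNeq => bxy; apply: (phi_nbr_s x0).
by rewrite /adj /= lt_neqAle eq_sym bxy graph_ge0.
Qed.

(** As [s] contains the support of [phi] and its neighbours, every sum involved reduces to a sum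
    over [s]; [sum_ground_state] then isolates the Laplacian. *)
Lemma form_mulE : Defs.form b m q (fun x => u x * phi x) =
  \sum_(x <- s) u x * laplace b m q u x * phi x ^+ 2 * m x
  + 2^-1 * (\sum_(x <- s) \sum_(y <- s)
              b x y * (u x * u y) * (phi x - phi y) ^+ 2).
Proof.
have gradE x : grad2 b m (fun x => u x * phi x) x = (2 * m x)^-1 *
    \sum_(y <- s) b x y * (u x * phi x - u y * phi y) ^+ 2.
  rewrite /grad2 (rsumE s_uniq)// => y ys; rewrite (phi0 ys) mulr0 subr0.
  have [->|x0] := eqVneq (phi x) 0; first by rewrite mulr0 expr0n mulr0.
  by rewrite b0 ?mul0r.
rewrite /Defs.form (rsumE s_uniq); last first.
  move=> x xs; rewrite gradE (phi0 xs) mulr0 expr0n mulr0 addr0.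
  rewrite big1 ?mulr0 ?mul0r// => y _.
  have [->|y0] := eqVneq (phi y) 0.
    by rewrite mulr0 subr0 expr0n mulr0.
  by rewrite (graph_sym graph_b) b0 ?mul0r.
transitivity (2^-1 * (\sum_(x <- s) \sum_(y <- s)
    b x y * (u x * phi x - u y * phi y) ^+ 2)
    + \sum_(x <- s) q x * (u x * phi x) ^+ 2 * m x).
  rewrite mulr_sumr -big_split; apply: eq_bigr => x _ /=.
  by rewrite gradE; field; rewrite gt_eqF.
rewrite sum_ground_state; last exact: (graph_sym graph_b).
rewrite addrAC; congr (_ + _); rewrite -big_split; apply: eq_bigr => x _ /=.
have [->|x0] := eqVneq (phi x) 0.
  rewrite big1; first by rewrite mulr0 expr0n !mulr0 !mul0r addr0.
  by move=> y _; rewrite expr0n mulr0.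
rewrite /laplace (rsumE s_uniq); last by move=> y ys; rewrite b0 ?mul0r.
rewrite -[in LHS]mulr_suml -[in LHS]mulr_suml.
by field; rewrite gt_eqF.
Qed.

(** The product [u x * u y] in the ground state term is at most half the sum of the squares, and the
    symmetry of [b] turns these into squares at [x] alone. *)
Lemma form_ge_mul_le (w : X -> R) : form_ge b m q w ->
  \sum_(x <- s) w x * u x ^+ 2 * phi x ^+ 2 * m x <=
  \sum_(x <- s) u x * laplace b m q u x * phi x ^+ 2 * m x
  + 2^-1 * (\sum_(x <- s) u x ^+ 2 *
              \sum_(y <- s) b x y * (phi x - phi y) ^+ 2).
Proof.
move=> /(_ (fun x => u x * phi x)).
rewrite form_mulE (rsumE s_uniq); last first.
  by move=> x xs; rewrite (phi0 xs) mulr0 expr0n mulr0 mul0r.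
move=> hw; apply: le_trans (_ : _ <= \sum_(x <- s) w x * (u x * phi x) ^+ 2 * m x) _.
  by apply: ler_sum => x _; rewrite exprMn !mulrA.
apply: le_trans (hw _) _.
  apply: (sub_finite_set _ (finite_seq s)) => x /=.
  by rewrite mulf_eq0 negb_or => /andP[_ /phi_s].
rewrite lerD2l ler_pM2l ?invr_gt0//.
set S := (leRHS).
have -> : S = 2^-1 * (\sum_(x <- s) \sum_(y <- s)
    b x y * (u x ^+ 2 + u y ^+ 2) * (phi x - phi y) ^+ 2).
  have SE : S = \sum_(x <- s) \sum_(y <- s)
      b x y * u x ^+ 2 * (phi x - phi y) ^+ 2.
    apply: eq_bigr => x _; rewrite mulr_sumr; apply: eq_bigr => y _.
    by rewrite mulrA (mulrC (u x ^+ 2)).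
  rewrite (_ : \sum_(x <- s) _ = S + S); first by field.
  rewrite SE [X in _ = _ + X]exchange_big -big_split; apply: eq_bigr => x _.
  rewrite -big_split; apply: eq_bigr => y _ /=.
  by rewrite (graph_sym graph_b y x); ring.
rewrite mulr_sumr; apply: ler_sum => x _.
rewrite mulr_sumr; apply: ler_sum => y _.
rewrite -subr_ge0 (_ : _ - _ = 2^-1 * (b x y * (u x - u y) ^+ 2 *
  (phi x - phi y) ^+ 2)); last by field.
rewrite mulr_ge0 ?invr_ge0// mulr_ge0 ?sqr_ge0// mulr_ge0 ?sqr_ge0//.
exact: (graph_ge0 graph_b).
Qed.

End GroundState.

(** * Elementary inequalities for exponentials and truncations *)

Lemma norm_expRB1 (R : realType) (t : R) :
  `|expR t - 1| <= `|t| * expR `|t|.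
Proof.
have := expR_ge1Dx t; have := expR_ge1Dx (- t).
have [t_ge0|t_lt0] := leP 0 t => hN h.
  rewrite ger0_norm ?(ger0_norm t_ge0); last by lra.
  have := expR_gt0 t; have : expR t * expR (- t) = 1.
    by rewrite -expRD subrr expR0.
  by nra.
rewrite (ltr0_norm t_lt0) ltr0_norm ?subr_lt0 ?expR_lt1//.
by nra.
Qed.

Lemma ler_norm_sqr (R : realDomainType) (x y : R) :
  `|x| <= `|y| -> x ^+ 2 <= y ^+ 2.
Proof.
move=> xy; rewrite -(real_normK (num_real x)) -(real_normK (num_real y)).
by rewrite lerXn2r ?nnegrE.
Qed.

(** Factoring out [expR s] leaves [1 - expR (t - s)], to which [norm_expRB1] applies. With [c] equal
    to alpha/2, the square of [expR c] is the factor e^alpha of the theorem. *)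
Lemma sqr_expRB_le (R : realType) (s t c : R) : `|s - t| <= c ->
  (expR s - expR t) ^+ 2 <= (expR s * expR c * (s - t)) ^+ 2.
Proof.
move=> stc; have -> : expR t = expR s * expR (t - s).
  by rewrite -expRD addrC subrK.
rewrite -[X in X - _]mulr1 -mulrBr; apply: ler_norm_sqr.
rewrite -mulrA !normrM ler_pM2l ?normr_gt0 ?gt_eqF ?expR_gt0//.
rewrite distrC (le_trans (norm_expRB1 _))// (distrC t) mulrC ler_wpM2r//.
by rewrite (ger0_norm (expR_ge0 c)) ler_expR.
Qed.

Lemma ler_sum_sub_seq (R : numDomainType) (X : eqType) (a : X -> R)
    (r s : seq X) : uniq r -> uniq s -> {subset r <= s} ->
  (forall x, 0 <= a x) -> \sum_(x <- r) a x <= \sum_(x <- s) a x.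
Proof.
move=> ur us rs a0; rewrite [leRHS](bigID (mem r)) /=.
rewrite (perm_big [seq x <- s | x \in r]) /=.
  by rewrite big_filter lerDl sumr_ge0.
apply: uniq_perm => //; first exact: filter_uniq.
by move=> x; rewrite mem_filter; case: (boolP (x \in r)) => // /rs ->.
Qed.

Lemma norm_maxrB_le (R : realDomainType) (x y z : R) :
  `|Num.max x z - Num.max y z| <= `|x - y|.
Proof.
wlog xy : x y / x <= y => [hw|].
  have [/hw//|/ltW/hw] := leP x y.
  by rewrite distrC [leRHS]distrC.
have [] := leP x z; have [] := leP y z => yz xz.
- by rewrite subrr normr0.
- by rewrite !ler0_norm; lra.
- by rewrite !ler0_norm; lra.
- by [].
Qed.

(** * The weighted estimate for an abstract weight [psi] *)

Section AgmonEstimate.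
Variables (R : realType) (X : choiceType) (b : X -> X -> R).
Hypothesis graph_b : is_graph b.
Hypothesis lf_b : locally_finite_graph b.
Variables (m q : X -> R).
Hypothesis m_gt0 : forall x, 0 < m x.
Variable d : X -> X -> R.
Hypothesis intr_d : intrinsic_metric b m d.
Variable w : X -> R.
Hypothesis w_ge0 : forall x, 0 <= w x.
Hypothesis h_ge_w : form_ge b m q w.
Variables f u psi : X -> R.
Hypothesis u_subsol : forall x, u x * laplace b m q u x <= u x * f x.
Hypothesis f_supp : forall x, w x = 0 -> f x = 0.
Hypothesis psi_ge0 : forall x, 0 <= psi x.
Hypothesis psi_fin : forall e : R, 0 < e -> finite_set [set x | e < psi x].
Variable c : R.
Hypothesis c_ge0 : 0 <= c.
Hypothesis c_lt1 : c < 1.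
Hypothesis psi_lip : forall x y, adj b x y ->
  (psi x - psi y) ^+ 2 <= 2 * c * psi x ^+ 2 * w x * d x y ^+ 2.
Hypothesis u_psi : weighted_ell2 (fun x => psi x ^+ 2 * w x * m x) u.
Variable F : R.
Hypothesis f_psi : forall s, uniq s ->
  \sum_(x <- s) f x ^+ 2 / w x * psi x ^+ 2 * m x <= F.

Let a x := u x ^+ 2 * (psi x ^+ 2 * w x * m x).
Let S := fine (\esum_(x in [set: X]) (a x)%:E)%E.

Let a_ge0 x : 0 <= a x.
Proof.
rewrite /a mulr_ge0 ?sqr_ge0// mulr_ge0 ?(ltW (m_gt0 x))//.
by rewrite mulr_ge0 ?sqr_ge0.
Qed.

Let SE : (\esum_(x in [set: X]) (a x)%:E = S%:E)%E.
Proof.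
rewrite fineK// ge0_fin_numE//.
by apply: esum_ge0 => x _; rewrite lee_fin.
Qed.

Let sum_a_le s : uniq s -> \sum_(x <- s) a x <= S.
Proof. by move=> us; rewrite -lee_fin -SE sum_seq_le_esum. Qed.

(** The first two terms come from AM-GM applied to u f psi^2, the last from the gradient of [psi].
    The AM-GM parameter [1 - c] leaves half of [(1 - c) * S] to absorb. *)
Let T : R := (1 - c) / 2 * S + (2 * (1 - c))^-1 * F + c * S.

(* The cut-off (psi - e)^+ is finitely supported and inherits the gradient
   bound of psi, but with psi rather than the cut-off on the right-hand side;
   this is harmless since the psi-weighted norm of u is already known to be
   finite. *)
Lemma truncated_sum_le (r : seq X) (e : R) : uniq r -> 0 < e ->
  \sum_(x <- r) w x * u x ^+ 2 * Num.max (psi x - e) 0 ^+ 2 * m x <= T.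
Proof.
move=> ur e0; pose phi x : R := Num.max (psi x - e) 0.
have phi_ge0 x : 0 <= phi x by rewrite le_max lexx orbT.
have phi_le x : phi x <= psi x by rewrite ge_max psi_ge0 andbT; lra.
have phi_neq0 x : phi x != 0 -> e < psi x.
  apply: contraNlt => xe; rewrite /phi max_r// subr_le0.
  by [].
(* Local finiteness keeps the set finite when neighbours are added; [r] is included so that its sum
   is dominated by the one over [s]. *)
have [s us [rs phis phin]] : exists2 s, uniq s & [/\ {subset r <= s},
    forall x, phi x != 0 -> x \in s &
    forall x y, phi x != 0 -> adj b x y -> y \in s].
  have fin_e := psi_fin e0.
  have /finite_seqP[t tE] : finite_set ([set x | e < psi x] `|`
      \bigcup_(x in [set x | e < psi x]) [set y | adj b x y]).
    by rewrite finite_setU; split=> //; apply: bigcup_finite.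
  have tP x : ([set x | e < psi x] `|`
      \bigcup_(x in [set x | e < psi x]) [set y | adj b x y]) x -> x \in t.
    by rewrite tE.
  exists (undup (r ++ t)); first exact: undup_uniq.
  split=> [x xr|x x0|x y x0 xy]; rewrite mem_undup mem_cat ?xr//.
    by rewrite tP ?orbT//; left; exact: phi_neq0.
  by rewrite tP ?orbT//; right; exists x => //; exact: phi_neq0.
apply: le_trans (_ : _ <= \sum_(x <- s) w x * u x ^+ 2 * phi x ^+ 2 * m x) _.
  apply: ler_sum_sub_seq => // x.
  by rewrite mulr_ge0 ?(ltW (m_gt0 x))// mulr_ge0 ?sqr_ge0// mulr_ge0 ?sqr_ge0.
apply: le_trans (form_ge_mul_le graph_b m_gt0 u us phis phin h_ge_w) _.
apply: lerD; last first.
  have sub_s : \sum_(x <- s) u x ^+ 2 *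
      (\sum_(y <- s) b x y * (phi x - phi y) ^+ 2) <=
      \sum_(x <- s) 2 * c * a x.
    apply: ler_sum => x _.
    have -> : 2 * c * a x = u x ^+ 2 * (2 * c * psi x ^+ 2 * w x * m x).
      by rewrite /a; ring.
    apply: ler_wpM2l; first exact: sqr_ge0.
    have K_ge0 : 0 <= 2 * c * psi x ^+ 2 * w x.
      by rewrite mulr_ge0// mulr_ge0 ?sqr_ge0// mulr_ge0.
    (* Summing the edgewise bound [psi_lip] against [b x y] produces the mass [m x], since [d] is
       intrinsic. *)
    apply: le_trans (_ : _ <= 2 * c * psi x ^+ 2 * w x *
        \sum_(y <- s) b x y * d x y ^+ 2) _; last first.
      rewrite ler_wpM2l// -lee_fin; apply: le_trans (intr_d.2 x).
      exact: sum_seq_le_esum.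
    rewrite mulr_sumr; apply: ler_sum => y _.
    rewrite [leRHS]mulrCA; have [xy|] := ltP 0 (b x y); last first.
      move=> b_le0; have -> : b x y = 0.
        by apply/eqP; rewrite eq_le b_le0 (graph_ge0 graph_b).
      by rewrite !mul0r.
    rewrite ler_pM2l//; apply: le_trans (psi_lip xy).
    apply: ler_norm_sqr.
    by apply: le_trans (norm_maxrB_le _ _ _) _; rewrite opprB addrA subrK.
  have -> : c * S = 2^-1 * (2 * c * S) by field.
  rewrite ler_pM2l ?invr_gt0//; apply: le_trans sub_s _.
  by rewrite -mulr_sumr ler_wpM2l ?sum_a_le// mulr_ge0.
have c1 : 0 < 1 - c by rewrite subr_gt0.
apply: le_trans (_ : _ <= \sum_(x <- s) ((1 - c) / 2 * a x +
    (2 * (1 - c))^-1 * (f x ^+ 2 / w x * psi x ^+ 2 * m x))) _; last first.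
  rewrite big_split /= -!mulr_sumr lerD// ler_wpM2l ?f_psi ?sum_a_le//.
    by rewrite divr_ge0 ?(ltW c1).
  by rewrite invr_ge0 mulr_ge0 ?(ltW c1).
apply: ler_sum => x _.
have phi2 : phi x ^+ 2 <= psi x ^+ 2 by rewrite lerXn2r ?nnegrE.
(* The sign of [u x * f x] is unknown, so the absolute value is taken before [phi] is enlarged to
   [psi]. *)
apply: le_trans (_ : _ <= `|u x * f x| * (psi x ^+ 2 * m x)) _.
  rewrite -mulrA; apply: le_trans (_ : _ <= `|u x * f x| * (phi x ^+ 2 * m x)) _.
    apply: ler_wpM2r; first by rewrite mulr_ge0 ?sqr_ge0 ?(ltW (m_gt0 x)).
    by rewrite (le_trans (u_subsol x))// ler_norm.
  by rewrite ler_wpM2l// ler_wpM2r// ltW.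
have -> : (1 - c) / 2 * a x +
    (2 * (1 - c))^-1 * (f x ^+ 2 / w x * psi x ^+ 2 * m x) =
  ((1 - c) / 2 * (u x ^+ 2 * w x) + (2 * (1 - c))^-1 * (f x ^+ 2 / w x)) *
    (psi x ^+ 2 * m x).
  by rewrite /a; ring.
apply: ler_wpM2r; first by rewrite mulr_ge0 ?sqr_ge0 ?(ltW (m_gt0 x)).
have [wx0|wx0] := eqVneq (w x) 0.
  by rewrite wx0 f_supp// !mulr0 normr0 expr0n mul0r !mulr0 addr0.
have wx_gt0 : 0 < w x by rewrite lt_neqAle eq_sym wx0 w_ge0.
(* AM-GM as a completed square, now that [w x] is positive. *)
have -> : (1 - c) / 2 * (u x ^+ 2 * w x) + (2 * (1 - c))^-1 * (f x ^+ 2 / w x) =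
   `|u x * f x| +
   ((1 - c) * w x * `|u x| - `|f x|) ^+ 2 / (2 * (1 - c) * w x).
  rewrite -(real_normK (num_real (u x))) -(real_normK (num_real (f x))) normrM.
  by field; rewrite wx0 gt_eqF.
rewrite lerDl divr_ge0 ?sqr_ge0//.
by rewrite !mulr_ge0 ?(ltW c1).
Qed.

(** Letting the cut-off level tend to 0 gives [S <= T]. Since [S] is a real number, its multiples in
    [T] can be moved to the left. *)
Lemma agmon_estimate (r : seq X) : uniq r ->
  \sum_(x <- r) a x <= (1 - c) ^- 2 * F.
Proof.
move=> ur; have c1 : 0 < 1 - c by rewrite subr_gt0.
apply: le_trans (sum_a_le ur) _.
suff : S <= T.
  rewrite -subr_ge0 => ST; rewrite -subr_ge0.
  rewrite (_ : _ - _ = (2 / (1 - c)) * (T - S)).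
    by rewrite mulr_ge0// divr_ge0// ltW.
  by rewrite /T; field; rewrite gt_eqF.
rewrite -lee_fin -SE; apply: esum_le_seq => s us; rewrite lee_fin.
(* At level [t] the squared cut-off is at least psi^2 - 2 t psi, so the loss over [s] is at most
   [t * D]. The choice [t = e / (D + 1)] makes this at most [e], even when [D] is 0. *)
pose D := 2 * \sum_(x <- s) w x * u x ^+ 2 * psi x * m x.
have D_ge0 : 0 <= D.
  rewrite mulr_ge0// sumr_ge0// => x _.
  by rewrite mulr_ge0 ?(ltW (m_gt0 x))// mulr_ge0// mulr_ge0 ?sqr_ge0.
apply/ler_addgt0Pr => e e0.
have e'0 : 0 < e / (D + 1) by rewrite divr_gt0// ltr_wpDl.
apply: le_trans (_ : _ <= T + e / (D + 1) * D) _; last first.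
  rewrite lerD2l mulrAC ler_pdivrMr ?ltr_wpDl// ler_pM2l//.
  by rewrite lerDl.
rewrite -lerBlDr; apply: le_trans (truncated_sum_le us e'0).
rewrite mulrA mulr_sumr -sumrB; apply: ler_sum => x _.
set t := e / _.
rewrite (_ : a x - _ =
    w x * u x ^+ 2 * m x * (psi x ^+ 2 - 2 * t * psi x)); last by rewrite /a; ring.
rewrite [leRHS](_ : _ = w x * u x ^+ 2 * m x * Num.max (psi x - t) 0 ^+ 2);
  last by ring.
apply: ler_wpM2l.
  by rewrite mulr_ge0 ?(ltW (m_gt0 x))// mulr_ge0 ?sqr_ge0.
have := psi_ge0 x; have [] := leP (psi x - t) 0 => pt p0.
  by rewrite expr0n /=; nra.
by nra.
Qed.

End AgmonEstimate.

(** * The exponential weight and its Lipschitz bound *)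

Section ExponentialWeight.
Variables (R : realType) (X : choiceType) (b d : X -> X -> R) (w : X -> R).
Hypothesis d_ge0 : forall x y, 0 <= d x y.
Hypothesis w_ge0 : forall x, 0 <= w x.
Hypothesis hrho : is_metric (rho_dist b d w).
Variables (o : X) (alpha k : R).
Hypothesis alpha_gt0 : 0 < alpha.

(* k - |rho - k| = min (rho, 2k - rho) *)
Definition exp_weight x :=
  expR (alpha / 2 * (k - `|rho_dist b d w o x - k|)).

Lemma exp_weight_le x :
  exp_weight x ^+ 2 <= expR (alpha * rho_dist b d w o x).
Proof.
rewrite -expRM_natl ler_expR mulrA mulrCA mulfV// mulr1 ler_pM2l//.
by have := ler_norm (k - rho_dist b d w o x); rewrite distrC; lra.
Qed.

(** Uses the branch 2k - rho of the minimum: this is how the a priori assumption makes the weighted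
    norm of [u] finite. *)
Lemma exp_weight_le_opp x : exp_weight x ^+ 2 <=
  expR (2 * alpha * k) * expR (- alpha * rho_dist b d w o x).
Proof.
rewrite -expRM_natl -expRD ler_expR.
have := ler_norm (rho_dist b d w o x - k).
by rewrite -(ler_pM2l alpha_gt0) mulrBr; lra.
Qed.

Lemma exp_weightE x : rho_dist b d w o x <= k ->
  exp_weight x ^+ 2 = expR (alpha * rho_dist b d w o x).
Proof.
move=> xk; rewrite /exp_weight -expRM_natl; congr expR.
by rewrite ler0_norm ?subr_le0//; field.
Qed.

(** Across an edge k - |rho - k| changes by at most the edge length. The cap 1 in that length
    controls the exponential factor, the other entry of the minimum supplies w d^2. *)
Lemma exp_weight_lip x y : adj b x y ->
  (exp_weight x - exp_weight y) ^+ 2 <=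
  2 * (alpha ^+ 2 * expR alpha / 8) * exp_weight x ^+ 2 * w x * d x y ^+ 2.
Proof.
move=> xy; set rho := rho_dist b d w o; set gx := k - `|rho x - k|.
set gy := k - `|rho y - k|.
have gxy : `|gx - gy| <= edge_length d w x y.
  apply: le_trans (rho_dist_le_edge w d_ge0 xy).
  rewrite /gx /gy opprB addrC addrA subrK.
  apply: le_trans (ler_dist_dist _ _) _; rewrite opprB addrA subrK distrC.
  rewrite ler_distl -/rho.
  have := pmetric_triangle hrho.1 o x y; have := pmetric_triangle hrho.1 o y x.
  by rewrite (pmetric_sym hrho.1 y x) -/rho; lra.
have gxy1 : `|gx - gy| <= 1 by rewrite (le_trans gxy)// ge_min lexx.
have gxyd : (gx - gy) ^+ 2 <= w x * d x y ^+ 2.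
  apply: le_trans (_ : _ <= (Num.sqrt (Num.min (w x) (w y)) * d x y) ^+ 2) _.
    apply: ler_norm_sqr; rewrite (le_trans gxy)//.
    by rewrite (le_trans _ (ler_norm _))// ge_min lexx orbT.
  rewrite exprMn sqr_sqrtr ?le_min ?w_ge0// ler_wpM2r ?sqr_ge0//.
  by rewrite ge_min lexx.
have stc : `|alpha / 2 * gx - alpha / 2 * gy| <= alpha / 2.
  by rewrite -mulrBr normrM gtr0_norm ?divr_gt0// ler_piMr// ltW// divr_gt0.
apply: le_trans (sqr_expRB_le stc) _.
(* The constant obtained is alpha^2 e^alpha / 4; its excess factor 2 cancels the 1/2 of the ground
   state term. *)
have ealpha : expR alpha = expR (alpha / 2) ^+ 2.
  by rewrite -expRM_natl; congr expR; field.
rewrite [leLHS](_ : _ = 2 * (alpha ^+ 2 * expR alpha / 8) * exp_weight x ^+ 2 *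
    (gx - gy) ^+ 2); last by rewrite ealpha /exp_weight -/rho -/gx; field.
rewrite -[leRHS]mulrA ler_wpM2l// mulr_ge0 ?sqr_ge0// mulr_ge0//.
by rewrite divr_ge0// mulr_ge0 ?sqr_ge0 ?expR_ge0.
Qed.

(** The exponent is at most alpha/2 times 2k - rho; solving for rho gives the radius of a ball
    containing the superlevel set. *)
Lemma finite_exp_weight_gt e :
  (forall r, finite_set [set x | rho_dist b d w o x < r]) ->
  0 < e -> finite_set [set x | e < exp_weight x].
Proof.
move=> finB e0; apply: sub_finite_set (finB (2 * k - 2 / alpha * ln e)) => x /=.
rewrite -[ltLHS]lnK ?posrE// ltr_expR => le.
have := ler_norm (rho_dist b d w o x - k).
rewrite -(ltr_pM2l (_ : 0 < alpha / 2)) ?divr_gt0//.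
rewrite -(ler_pM2l (_ : 0 < alpha / 2)) ?divr_gt0//.
rewrite [ltRHS](_ : _ = alpha * k - ln e); last by field; rewrite gt_eqF.
by move: le; rewrite !mulrBr; lra.
Qed.

End ExponentialWeight.

(** * The estimate for the weight exp(alpha rho) *)

Unset Implicit Arguments.

Theorem theorem4p3 (R : realType) (X : countType)
    (infX : infinite_set [set: X])
    (m : X -> R) (m_gt0 : forall x, 0 < m x)
    (b : X -> X -> R) (graph_b : is_graph b)
    (lf_b : locally_finite_graph b) (conn_b : connected_graph b)
    (q : X -> R)
    (d : X -> X -> R) (intr_d : intrinsic_metric b m d)
    (w : X -> R) (w_ge0 : forall x, 0 <= w x)
    (h_ge_w : form_ge b m q w)
    (complete_rho : complete_metric (rho_dist b d w))
    (o : X) (f u : X -> R)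
    (u_dom : formal_domain b u)
    (u_sol : (forall x, laplace b m q u x = f x) \/
             ((forall x, 0 <= u x) /\ (forall x, laplace b m q u x <= f x)))
    (alpha : R) (alpha_gt0 : 0 < alpha)
    (alpha_small : alpha ^+ 2 * expR alpha / 8 < 1)
    (u_ell2 : weighted_ell2
       (fun x => expR (- alpha * rho_dist b d w o x) * w x * m x) u) :
  (\esum_(x in [set: X])
      (u x ^+ 2 * (expR (alpha * rho_dist b d w o x) * w x * m x))%:E
   <= ((1 - alpha ^+ 2 * expR alpha / 8) ^- 2)%:E *
      \esum_(x in [set: X])
        (sqr_over f w x * (expR (alpha * rho_dist b d w o x) * m x)%:E))%E
  /\
  (finitely_supported f -> (forall x, f x != 0 -> 0 < w x) ->
   weighted_ell2 (fun x => expR (alpha * rho_dist b d w o x) * w x * m x) u).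
Proof.
have d_ge0 := pmetric_ge0 intr_d.1.
have [hrho _] := complete_rho.
set rho := rho_dist b d w; set c := alpha ^+ 2 * expR alpha / 8.
have c_ge0 : 0 <= c by rewrite divr_ge0// mulr_ge0 ?sqr_ge0 ?expR_ge0.
have C_gt0 : 0 < (1 - c) ^- 2 by rewrite invr_gt0 exprn_gt0// subr_gt0.
set G := (X in (_ <= _ * X)%E).
have G_ge0 x : (0 <= sqr_over f w x * (expR (alpha * rho o x) * m x)%:E)%E.
  apply: mule_ge0; last by rewrite lee_fin mulr_ge0 ?expR_ge0// ltW.
  rewrite /sqr_over; case: eqP => // _; case: eqP => // _.
  by rewrite lee_fin divr_ge0 ?sqr_ge0.
have main : (\esum_(x in [set: X])
      (u x ^+ 2 * (expR (alpha * rho o x) * w x * m x))%:E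
    <= ((1 - c) ^- 2)%:E * G)%E.
  have [->|G_fin] := eqVneq G +oo%E.
    by rewrite gt0_muley ?leey// lte_fin.
  have GE : G = (fine G)%:E.
    by rewrite fineK// ge0_fin_numE ?esum_ge0// ltey.
  (* A single point with [w x = 0] and [f x != 0] would already make [G] infinite. *)
  have f_supp x : w x = 0 -> f x = 0.
    move=> wx0; apply: contrapT => /eqP fx0; move: G_fin; apply/negP/negPn.
    rewrite -leye_eq; apply: esum_ge; exists [set x].
      by split => //; exact: finite_set1.
    rewrite fsbig_set1 /sqr_over (negbTE fx0) wx0 eqxx gt0_mulye//.
    by rewrite lte_fin mulr_gt0 ?expR_gt0.
  have GsumE : G = (\esum_(x in [set: X])
      (f x ^+ 2 / w x * expR (alpha * rho o x) * m x)%:E)%E.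
    apply: eq_esum => x _; rewrite /sqr_over.
    have [fx0|fx0] := eqVneq (f x) 0.
      by rewrite fx0 expr0n !mul0r mul0e.
    rewrite ifF; first by rewrite -EFinM mulrA.
    by apply/negP => /eqP /f_supp /eqP; exact/negP.
  have u_subsol x : u x * laplace b m q u x <= u x * f x.
    case: u_sol => [->//|[u_ge0 Lu]].
    by rewrite ler_wpM2l.
  apply: esum_le_seq => s us; rewrite GE -EFinM lee_fin.
  (* Any bound for [rho o] on [s] serves: there the weight [psi ^+ 2] equals exp(alpha rho), while
     the bound by [G] is uniform in [k]. *)
  pose k := \sum_(x <- s) rho o x.
  have sk x : x \in s -> rho o x <= k.
    move=> xs; rewrite /k (big_rem x)//= lerDl sumr_ge0// => y _.
    exact: (pmetric_ge0 hrho.1).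
  pose psi := exp_weight b d w o alpha k.
  rewrite (eq_big_seq (fun x => u x ^+ 2 * (psi x ^+ 2 * w x * m x))); last first.
    by move=> x /sk xk; rewrite /psi exp_weightE.
  apply: (@agmon_estimate _ _ _ graph_b lf_b _ _ m_gt0 _ intr_d _ w_ge0 h_ge_w
    _ _ psi u_subsol f_supp _ _ c) => //.
  - by move=> x; exact: expR_ge0.
  - move=> e e0; apply: finite_exp_weight_gt => // r.
    by apply: finite_ball => //; exact: (graph_diag graph_b).
  - by move=> x y xy; exact: exp_weight_lip.
  - apply: le_lt_trans (_ : _ <= (expR (2 * alpha * k) *
      fine (\esum_(x in [set: X])
        (u x ^+ 2 * (expR (- alpha * rho o x) * w x * m x))%:E))%:E)%E _;
      last exact: ltry.
    apply: esum_le_seq => t ut; rewrite lee_fin.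
    apply: le_trans (_ : _ <= expR (2 * alpha * k) *
      \sum_(x <- t) u x ^+ 2 * (expR (- alpha * rho o x) * w x * m x)) _.
      rewrite mulr_sumr; apply: ler_sum => x _.
      rewrite [leRHS]mulrCA ler_wpM2l ?sqr_ge0// !mulrA ler_wpM2r ?(ltW (m_gt0 x))//.
      by rewrite ler_wpM2r// exp_weight_le_opp.
    rewrite ler_wpM2l ?expR_ge0// -lee_fin fineK ?sum_seq_le_esum//.
    rewrite ge0_fin_numE//; apply: esum_ge0 => x _; rewrite lee_fin.
    by rewrite mulr_ge0 ?sqr_ge0// mulr_ge0 ?(ltW (m_gt0 x))// mulr_ge0 ?expR_ge0.
  - move=> t ut; apply: le_trans (_ : _ <=
      \sum_(x <- t) f x ^+ 2 / w x * expR (alpha * rho o x) * m x) _.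
      apply: ler_sum => x _; rewrite ler_wpM2r ?(ltW (m_gt0 x))//.
      by rewrite ler_wpM2l ?exp_weight_le// divr_ge0 ?sqr_ge0.
    by rewrite -lee_fin -GE GsumE sum_seq_le_esum.
split=> // f_fin f_w; apply: le_lt_trans main _.
have /finite_seqP[s0 s0E] := f_fin.
(* Where [f] is nonzero [w] is positive, so no term is infinite and [G] is a finite sum of reals. *)
suff -> : G = (\sum_(x <- undup s0)
    f x ^+ 2 / w x * (expR (alpha * rho o x) * m x))%:E.
  by rewrite -EFinM ltry.
rewrite -esum_seqE ?undup_uniq//.
- apply: eq_esum => x _; rewrite /sqr_over.
  have [fx0|fx0] := eqVneq (f x) 0.
    by rewrite fx0 expr0n !mul0r mul0e.
  by rewrite gt_eqF ?f_w// -EFinM.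
- move=> x; rewrite mulr_ge0//; first by rewrite divr_ge0 ?sqr_ge0.
  by rewrite mulr_ge0 ?expR_ge0 ?(ltW (m_gt0 x)).
- move=> x; rewrite mem_undup => xs.
  suff -> : f x = 0 by rewrite expr0n !mul0r.
  apply/eqP; apply: contraNT xs => fx0.
  by have : [set x | f x != 0] x by []; rewrite s0E.
Qed.
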